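(* Let $N\ge 2$ and let $\alpha=(\alpha[1]\to\cdots\to\alpha[N])$ be an $N$-node serial episode. Let $\alpha_p=(\alpha[1]\to\cdots\to\alpha[N-1])$ be its $(N-1)$-node prefix subepisode and $\alpha_s=(\alpha[2]\to\cdots\to\alpha[N])$ its $(N-1)$-node suffix subepisode. Let $\mathbb{D}$ be an event sequence. (i) If the minimal-occurrences-based frequency of $\alpha$ in $\mathbb{D}$ is $f$, then the minimal-occurrences-based frequencies of $\alpha_p$ and of $\alpha_s$ in $\mathbb{D}$ are both at least $f$. (ii) If the non-interleaved frequency of $\alpha$ in $\mathbb{D}$ is $f$, then the non-interleaved frequencies of $\alpha_p$ and of $\alpha_s$ in $\mathbb{D}$ are both at least $f$.
   Context: An event sequence is $\mathbb{D}=\langle (E_1,t_1),\ldots,(E_n,t_n)\rangle$, where each event-type $E_i$ belongs to a finite alphabet, each $t_i$ is a positive integer, and $t_i\le t_{i+1}$. An $M$-node serial episode is a sequence of event-types $\gamma=(\gamma[1]\to\cdots\to\gamma[M])$ with nodes $v_1,\ldots,v_M$. An occurrence of $\gamma$ in $\mathbb{D}$ is a map $h:\{v_1,\ldots,v_M\}\to\{1,\ldots,n\}$ with $E_{h(v_i)}=\gamma[i]$ for all $i$ and $t_{h(v_1)}<\cdots<t_{h(v_M)}$. Minimal-occurrences-based frequency: the time-window of an occurrence $h$ of $\gamma$ is $[t_{h(v_1)},t_{h(v_M)}]$; a minimal window of $\gamma$ is a time-window containing an occurrence of $\gamma$ such that no proper sub-window of it contains an occurrence of $\gamma$; the frequency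 is the number of minimal windows of $\gamma$ in $\mathbb{D}$. Non-interleaved frequency: two occurrences $h_1,h_2$ of $\gamma$ are non-interleaved if either $t_{h_2(v_j)}\ge t_{h_1(v_{j+1})}$ for all $j=1,\ldots,M-1$, or $t_{h_1(v_j)}\ge t_{h_2(v_{j+1})}$ for all $j=1,\ldots,M-1$; the frequency is the largest cardinality of a set of occurrences of $\gamma$ in $\mathbb{D}$ any two different members of which are non-interleaved. *)

(* Defs.v *)
(* An episode with M >= 1 nodes is indexed by m with
   M = m.+1: the node v_(i+1) is i : 'I_m.+1, and j : 'I_m stands for the pair
   of consecutive nodes (pred_node j, succ_node j) = (v_(j+1), v_(j+2)). *)
From mathcomp Require Import all_boot.

Set Implicit Arguments.
Unset Strict Implicit.
Unset Printing Implicit Defensive.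

Record event_sequence (E : finType) := EventSequence {
  events :> seq (E * nat);
  events_time_gt0 : all (fun e => 0 < e.2) events;
  events_sorted : sorted leq [seq e.2 | e <- events]
}.

Definition etype (E : finType) (D : event_sequence E) (i : 'I_(size D)) : E :=
  (tnth (in_tuple D) i).1.

Definition etime (E : finType) (D : event_sequence E) (i : 'I_(size D)) : nat :=
  (tnth (in_tuple D) i).2.

Definition episode (E : finType) (M : nat) : Type := M.-tuple E.

Definition pred_node m (j : 'I_m) : 'I_m.+1 := widen_ord (leqnSn m) j.
Definition succ_node m (j : 'I_m) : 'I_m.+1 := lift ord0 j.

Definition prefix_episode (E : finType) m (g : episode E m.+1) : episode E m :=
  [tuple tnth g (pred_node j) | j < m].

Definition suffix_episode (E : finType) m (g : episode E m.+1) : episode E m :=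
  [tuple tnth g (succ_node j) | j < m].

Definition node_map (E : finType) (D : event_sequence E) (M : nat) : finType :=
  {ffun 'I_M -> 'I_(size D)}.

Definition occurrence (E : finType) (D : event_sequence E) m
    (g : episode E m.+1) (h : node_map D m.+1) : bool :=
  [forall i, etype (h i) == tnth g i] &&
  [forall j : 'I_m, etime (h (pred_node j)) < etime (h (succ_node j))].

(* The pair (a, b) stands for the time-window [a, b]. *)
Definition time_window (E : finType) (D : event_sequence E) m
    (h : node_map D m.+1) : nat * nat :=
  (etime (h ord0), etime (h ord_max)).

Definition sub_window (w' w : nat * nat) : bool :=
  (w.1 <= w'.1) && (w'.2 <= w.2).

Definition contains_occurrence (E : finType) (D : event_sequence E) m
    (g : episode E m.+1) (w : nat * nat) : bool :=
  [exists h : node_map D m.+1, occurrence g h && sub_window (time_window h) w].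

(* The endpoints of a sub-window [c, d] of w (c <= d) are at most w.2, so the
   bounded quantifiers reach every sub-window; see minimal_windowP. *)
Definition minimal_window (E : finType) (D : event_sequence E) m
    (g : episode E m.+1) (w : nat * nat) : bool :=
  contains_occurrence D g w &&
  [forall c : 'I_w.2.+1, forall d : 'I_w.2.+1,
     (sub_window (val c, val d) w && ((val c, val d) != w)) ==>
       ~~ contains_occurrence D g (val c, val d)].

Definition horizon (E : finType) (D : event_sequence E) : nat :=
  \max_(i < size D) etime i.

(* No minimal window is missed by bounding the endpoints by the last time
   stamp; see minimal_window_horizon. *)
Definition mo_frequency (E : finType) (D : event_sequence E) m
    (g : episode E m.+1) : nat :=
  #|[set w : 'I_(horizon D).+1 * 'I_(horizon D).+1
     | minimal_window D g (val w.1, val w.2)]|.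

Definition non_interleaved (E : finType) (D : event_sequence E) m
    (h1 h2 : node_map D m.+1) : bool :=
  [forall j : 'I_m, etime (h2 (pred_node j)) >= etime (h1 (succ_node j))] ||
  [forall j : 'I_m, etime (h1 (pred_node j)) >= etime (h2 (succ_node j))].

Definition non_interleaved_family (E : finType) (D : event_sequence E) m
    (g : episode E m.+1) (H : {set node_map D m.+1}) : bool :=
  [forall h in H, occurrence g h] &&
  [forall h1 in H, forall h2 in H, (h1 != h2) ==> non_interleaved h1 h2].

Definition ni_frequency (E : finType) (D : event_sequence E) m
    (g : episode E m.+1) : nat :=
  \max_(H : {set node_map D m.+1} | non_interleaved_family g H) #|H|.

Lemma occurrence_le (E : finType) (D : event_sequence E) m
    (g : episode E m.+1) (h : node_map D m.+1) :
  occurrence g h -> etime (h ord0) <= etime (h ord_max).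
Proof.
case/andP=> _ /forallP H.
have key k : forall lt_k : k < m.+1, etime (h ord0) <= etime (h (Ordinal lt_k)).
  elim: k => [|k IHk] lt_k; first by rewrite (_ : Ordinal lt_k = ord0) //; apply: val_inj.
  apply: leq_trans (IHk (ltnW lt_k)) _.
  have := H (Ordinal (lt_k : k < m)).
  rewrite (_ : pred_node _ = Ordinal (ltnW lt_k)); last exact: val_inj.
  rewrite (_ : succ_node _ = Ordinal lt_k); last exact: val_inj.
  exact: ltnW.
by rewrite (_ : ord_max = Ordinal (ltnSn m)) //; apply: val_inj.
Qed.

Lemma minimal_windowP (E : finType) (D : event_sequence E) m
    (g : episode E m.+1) (w : nat * nat) :
  reflect (contains_occurrence D g w /\
           forall w', sub_window w' w -> w' <> w -> ~ contains_occurrence D g w')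
          (minimal_window D g w).
Proof.
apply: (iffP andP) => -[Hw Hmin]; split=> //.
  move=> w' sw /eqP nw Hw'.
  have le_w' : w'.1 <= w'.2.
    case/existsP: Hw' => h /andP[/occurrence_le le_h /andP[/= H1 H2]].
    exact: leq_trans H1 (leq_trans le_h H2).
  have Hd : w'.2 < w.2.+1 by case/andP: sw.
  have Hc : w'.1 < w.2.+1 by apply: leq_ltn_trans Hd.
  have := forallP (forallP Hmin (Ordinal Hc)) (Ordinal Hd).
  by rewrite /= -surjective_pairing sw nw Hw'.
apply/forallP=> c; apply/forallP=> d; apply/implyP=> /andP[sw /eqP nw].
by apply/negP; apply: Hmin.
Qed.

Lemma minimal_window_occurrence (E : finType) (D : event_sequence E) m
    (g : episode E m.+1) (w : nat * nat) :
  minimal_window D g w ->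
  exists2 h : node_map D m.+1, occurrence g h & time_window h = w.
Proof.
case/minimal_windowP=> /existsP[h /andP[occ sw]] Hmin; exists h => //.
apply/eqP/negPn/negP=> /eqP nw; apply: (Hmin _ sw nw).
by apply/existsP; exists h; rewrite occ /sub_window !leqnn.
Qed.

Lemma minimal_window_horizon (E : finType) (D : event_sequence E) m
    (g : episode E m.+1) (w : nat * nat) :
  minimal_window D g w -> (w.1 <= horizon D) && (w.2 <= horizon D).
Proof.
case/minimal_window_occurrence=> h _ <-; rewrite /horizon /=.
by rewrite !(leq_bigmax (F := @etime E D)).
Qed.

(* Main.v *)
(* (i) A minimal window [a, b] of alpha contains a minimal window [c, d] of the
   prefix with d < b.  If a < c, adding the last event of alpha at time b would
   give an occurrence of alpha in [c, b]; hence c = a.  Two minimal windows of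
   alpha with the same left end coincide, so [a, b] |-> [a, d] is injective.
   The suffix is symmetric, with right ends.
   (ii) Restriction preserves non-interleaving, and it is injective on a
   non-interleaved family, since such occurrences differ in time at the first
   and at the last node. *)
Require Import Defs.
From mathcomp Require Import all_boot.

Set Implicit Arguments.
Unset Strict Implicit.
Unset Printing Implicit Defensive.

(** * Splitting off the first or the last node *)

Lemma pred_nodeE m (j : 'I_m) : pred_node j = lift ord_max j.
Proof. by apply: ord_inj; rewrite lift_max. Qed.

(** Widening and shifting commute, so a pair of consecutive nodes of either restriction is a
    consecutive pair of the whole episode. *)
Lemma succ_pred_node m (j : 'I_m) :
  succ_node (pred_node j) = pred_node (succ_node j).
Proof. exact: val_inj. Qed.

Lemma pred_node0 m : pred_node (ord0 : 'I_m.+1) = ord0.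
Proof. exact: val_inj. Qed.

Lemma succ_node_max m : succ_node (ord_max : 'I_m.+1) = ord_max.
Proof. exact: val_inj. Qed.

Lemma forall_ord_recr m (P : pred 'I_m.+1) :
  [forall i, P i] = [forall j : 'I_m, P (pred_node j)] && P ord_max.
Proof.
apply/forallP/andP=> [HP | [/forallP HP Pmax] i].
  by split=> //; apply/forallP.
by case: (unliftP ord_max i) => [j|] ->; rewrite -?pred_nodeE.
Qed.

Lemma forall_ord_recl m (P : pred 'I_m.+1) :
  [forall i, P i] = P ord0 && [forall j : 'I_m, P (succ_node j)].
Proof.
apply/forallP/andP=> [HP | [P0 /forallP HP] i].
  by split=> //; apply/forallP.
by case: (unliftP ord0 i) => [j|] -> //; apply: HP.
Qed.

Section Events.

Variables (E : finType) (D : event_sequence E).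

(** * Restricting and extending occurrences *)

Definition prefix_map m (h : node_map D m.+1) : node_map D m :=
  [ffun j => h (pred_node j)].

Definition suffix_map m (h : node_map D m.+1) : node_map D m :=
  [ffun j => h (succ_node j)].

(** [unlift ord_max j] is [None] only at the last node, so [oapp] puts the default [i] there and [h]
    everywhere else. *)
Definition rcons_map m (h : node_map D m) (i : 'I_(size D)) : node_map D m.+1 :=
  [ffun j => oapp h i (unlift ord_max j)].

Definition cons_map m (i : 'I_(size D)) (h : node_map D m) : node_map D m.+1 :=
  [ffun j => oapp h i (unlift ord0 j)].

Lemma rcons_map_max m (h : node_map D m) i : rcons_map h i ord_max = i.
Proof. by rewrite ffunE unlift_none. Qed.

Lemma rcons_mapK m (h : node_map D m) i : prefix_map (rcons_map h i) = h.
Proof. by apply/ffunP=> j; rewrite !ffunE pred_nodeE liftK. Qed.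

Lemma cons_map0 m i (h : node_map D m) : cons_map i h ord0 = i.
Proof. by rewrite ffunE unlift_none. Qed.

Lemma cons_mapK m i (h : node_map D m) : suffix_map (cons_map i h) = h.
Proof. by apply/ffunP=> j; rewrite !ffunE liftK. Qed.

Lemma occurrence_recr m (g : episode E m.+2) (h : node_map D m.+2) :
  occurrence g h =
  [&& occurrence (prefix_episode g) (prefix_map h),
      etype (h ord_max) == tnth g ord_max
    & etime (prefix_map h ord_max) < etime (h ord_max)].
Proof.
(* The first rewrite splits off a node, the second a pair of consecutive nodes; [andbACA] then
   gathers the two conditions that concern the prefix alone. *)
rewrite /occurrence [X in X && _]forall_ord_recr [X in _ && X]forall_ord_recr.
rewrite succ_node_max ffunE andbACA.
congr ((_ && _) && _); apply: eq_forallb => j.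
  by rewrite tnth_mktuple ffunE.
by rewrite !ffunE succ_pred_node.
Qed.

Lemma occurrence_recl m (g : episode E m.+2) (h : node_map D m.+2) :
  occurrence g h =
  [&& occurrence (suffix_episode g) (suffix_map h),
      etype (h ord0) == tnth g ord0
    & etime (h ord0) < etime (suffix_map h ord0)].
Proof.
rewrite /occurrence [X in X && _]forall_ord_recl [X in _ && X]forall_ord_recl.
rewrite pred_node0 ffunE andbACA andbC.
congr ((_ && _) && _); apply: eq_forallb => j.
  by rewrite tnth_mktuple ffunE.
by rewrite !ffunE succ_pred_node.
Qed.

(** * Minimal windows and their ends *)

Lemma contains_occurrence_le m (g : episode E m.+1) w :
  contains_occurrence D g w -> w.1 <= w.2.
Proof.
case/existsP=> h /andP[/occurrence_le le_h /andP[le1 le2]].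
exact: leq_trans le1 (leq_trans le_h le2).
Qed.

Lemma sub_window_trans w2 w1 w3 :
  sub_window w1 w2 -> sub_window w2 w3 -> sub_window w1 w3.
Proof.
move=> /andP[l12 r12] /andP[l23 r23].
by rewrite /sub_window (leq_trans l23 l12) (leq_trans r12 r23).
Qed.

(** Strong induction on the length [w.2 - w.1]: a window that is not minimal has a strictly shorter
    sub-window that still contains an occurrence. *)
Lemma minimal_window_exists m (g : episode E m.+1) w :
  contains_occurrence D g w ->
  exists2 w', minimal_window D g w' & sub_window w' w.
Proof.
have [n] := ubnP (w.2 - w.1); elim: n w => // n IHn w lt_wn Hw.
have [min_w | nmin_w] := boolP (minimal_window D g w).
  by exists w; rewrite // /sub_window !leqnn.
move: nmin_w; rewrite /minimal_window Hw /= negb_forall => /existsP[c].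
rewrite negb_forall => /existsP[d]; rewrite negb_imply negbK.
move: (val c) (val d) => {}c {}d /andP[/andP[sw neq_w] Hcd].
have lt_cd : d - c < n.
  (* Subtraction is truncated, so [c <= d] matters: it keeps the length of [w] positive, and moving
     either end inwards then makes it strictly smaller. *)
  move: (contains_occurrence_le Hcd) sw neq_w lt_wn => /= le_cd.
  case: w {Hw} => a b /andP[/= le_ac le_db] neq_w lt_ab.
  rewrite -ltnS (leq_trans _ lt_ab) // ltnS.
  move: neq_w; rewrite xpair_eqE negb_and => /orP[neq|neq].
    have lt_ac : a < c by rewrite ltn_neqAle eq_sym neq.
    apply: leq_trans (leq_sub2r a le_db).
    by rewrite ltn_sub2l // (leq_trans lt_ac).
  have lt_db : d < b by rewrite ltn_neqAle neq.
  apply: leq_trans (leq_sub2l b le_ac).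
  by rewrite ltn_sub2r // (leq_ltn_trans le_cd).
have [w' min_w' sw'] := IHn (c, d) lt_cd Hcd.
by exists w' => //; apply: sub_window_trans sw' sw.
Qed.

Lemma minimal_window_sub m (g : episode E m.+1) w w' :
  minimal_window D g w -> contains_occurrence D g w' -> sub_window w' w ->
  w' = w.
Proof.
case/minimal_windowP=> _ min_w Hw' sw.
by have [|/eqP neq] := eqVneq w' w => //; case: (min_w _ sw neq).
Qed.

(** Windows with a common left end are nested, and minimality of the larger one makes them equal. *)
Lemma minimal_window_eql m (g : episode E m.+1) w w' :
  minimal_window D g w -> minimal_window D g w' -> w.1 = w'.1 -> w = w'.
Proof.
move=> min_w min_w' eq1.
have /andP[Hw _] := min_w; have /andP[Hw' _] := min_w'.
have [le2 | /ltnW le2] := leqP w.2 w'.2; last apply/esym.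
  by apply: minimal_window_sub min_w' Hw _; rewrite /sub_window eq1 leqnn.
by apply: minimal_window_sub min_w Hw' _; rewrite /sub_window eq1 leqnn.
Qed.

Lemma minimal_window_eqr m (g : episode E m.+1) w w' :
  minimal_window D g w -> minimal_window D g w' -> w.2 = w'.2 -> w = w'.
Proof.
move=> min_w min_w' eq2.
have /andP[Hw _] := min_w; have /andP[Hw' _] := min_w'.
have [le1 | /ltnW le1] := leqP w'.1 w.1; last apply/esym.
  by apply: minimal_window_sub min_w' Hw _; rewrite /sub_window eq2 le1 leqnn.
by apply: minimal_window_sub min_w Hw' _; rewrite /sub_window eq2 le1 leqnn.
Qed.

Lemma minimal_window_prefix m (g : episode E m.+2) w :
  minimal_window D g w ->
  exists2 w', minimal_window D (prefix_episode g) w' & w'.1 = w.1.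
Proof.
move=> min_w; have [h] := minimal_window_occurrence min_w.
rewrite occurrence_recr => /and3P[occ_p typ_h lt_h] def_w.
have Hp : contains_occurrence D (prefix_episode g)
            (w.1, etime (prefix_map h ord_max)).
  apply/existsP; exists (prefix_map h).
  by rewrite occ_p /sub_window /= ffunE pred_node0 -def_w !leqnn.
have [w' min_w' /andP[/= le1 le2]] := minimal_window_exists Hp.
exists w' => //; have [k occ_k def_w'] := minimal_window_occurrence min_w'.
(* By [le2], [k] ends no later than [prefix_map h], hence strictly before the last event of [h],
   which can therefore be appended to [k]. *)
have Hg : contains_occurrence D g (w'.1, w.2).
  apply/existsP; exists (rcons_map k (h ord_max)).
  rewrite occurrence_recr rcons_mapK occ_k rcons_map_max typ_h /=.
  rewrite /sub_window /time_window /= rcons_map_max.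
  (* Seen as a [pred_node], the first node lies in the prefix, where [rcons_mapK] gives its
     value. *)
  rewrite -pred_node0.
  have -> : rcons_map k (h ord_max) (pred_node ord0) = k ord0.
    by rewrite -{2}(rcons_mapK k (h ord_max)) [in RHS]ffunE.
  rewrite -def_w -def_w' /= !leqnn !andbT.
  by move: le2; rewrite -def_w' => /= /leq_ltn_trans; apply.
have := minimal_window_sub min_w Hg; rewrite /sub_window le1 leqnn.
by case/(_ isT)/(congr1 fst).
Qed.

Lemma minimal_window_suffix m (g : episode E m.+2) w :
  minimal_window D g w ->
  exists2 w', minimal_window D (suffix_episode g) w' & w'.2 = w.2.
Proof.
move=> min_w; have [h] := minimal_window_occurrence min_w.
rewrite occurrence_recl => /and3P[occ_s typ_h lt_h] def_w.
have Hs : contains_occurrence D (suffix_episode g)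
            (etime (suffix_map h ord0), w.2).
  apply/existsP; exists (suffix_map h).
  rewrite occ_s /sub_window /= [suffix_map h ord_max]ffunE succ_node_max.
  by rewrite -def_w !leqnn.
have [w' min_w' /andP[/= le1 le2]] := minimal_window_exists Hs.
exists w' => //; have [k occ_k def_w'] := minimal_window_occurrence min_w'.
(* By [le1], [k] starts no earlier than [suffix_map h], hence strictly after the first event of [h],
   which can be put in front. *)
have Hg : contains_occurrence D g (w.1, w'.2).
  apply/existsP; exists (cons_map (h ord0) k).
  rewrite occurrence_recl cons_mapK occ_k cons_map0 typ_h /=.
  rewrite /sub_window /time_window /= cons_map0 -succ_node_max.
  have -> : cons_map (h ord0) k (succ_node ord_max) = k ord_max.
    by rewrite -{2}(cons_mapK (h ord0) k) [in RHS]ffunE.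
  rewrite -def_w -def_w' /= !leqnn !andbT.
  by move: le1; rewrite -def_w' => /= /(leq_trans lt_h).
have := minimal_window_sub min_w Hg; rewrite /sub_window le2 leqnn.
by case/(_ isT)/(congr1 snd).
Qed.

(** * Comparing minimal-occurrences-based frequencies *)

(** Here [p] is the end of the window that is preserved: [fst] for the prefix, [snd] for the suffix.
    As [p] determines a minimal window of [g], any choice of [w'] is injective. *)
Lemma leq_mo_frequency m m' (g : episode E m.+1) (g' : episode E m'.+1)
    (p : nat * nat -> nat) :
  (forall w1 w2, minimal_window D g w1 -> minimal_window D g w2 ->
     p w1 = p w2 -> w1 = w2) ->
  (forall w, minimal_window D g w ->
     exists2 w', minimal_window D g' w' & p w' = p w) ->
  mo_frequency D g <= mo_frequency D g'.
Proof.
move=> inj_p ex_p; rewrite /mo_frequency.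
set A := [set w | minimal_window D g _].
set B := [set w | minimal_window D g' _].
pose W := ('I_(horizon D).+1 * 'I_(horizon D).+1)%type.
pose v (w : W) : nat * nat := (val w.1, val w.2).
have inA w : (w \in A) = minimal_window D g (v w) by rewrite inE.
have inB w : (w \in B) = minimal_window D g' (v w) by rewrite inE.
(* A choice function on all of [W]; outside [A] its value is arbitrary, here [w] itself. *)
have /fin_all_exists[f fP] (w : W) : exists w' : W,
    w \in A -> w' \in B /\ p (v w') = p (v w).
  have [wA | _] := boolP (w \in A); last by exists w.
  move: wA; rewrite inA => /ex_p[w' min_w' eq_p].
  have /andP[h1 h2] := minimal_window_horizon min_w'.
  exists (Ordinal (h1 : w'.1 < _.+1), Ordinal (h2 : w'.2 < _.+1)) => _.
  by rewrite inB /v /= -surjective_pairing.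
rewrite -(@card_in_imset _ _ f); last first.
  move=> w1 w2 A1 A2 eq_f; have [_ e1] := fP _ A1; have [_ e2] := fP _ A2.
  have : v w1 = v w2.
    by apply: inj_p; rewrite -?inA // -e1 -e2 eq_f.
  by move: w1 w2 {A1 A2 eq_f e1 e2} => [a b] [c d] [/val_inj-> /val_inj->].
by apply/subset_leq_card/subsetP=> _ /imsetP[w /fP[fB _] ->].
Qed.

Lemma leq_mo_frequency_prefix m (g : episode E m.+2) :
  mo_frequency D g <= mo_frequency D (prefix_episode g).
Proof.
apply: (leq_mo_frequency (p := fst)); first exact: minimal_window_eql.
exact: minimal_window_prefix.
Qed.

Lemma leq_mo_frequency_suffix m (g : episode E m.+2) :
  mo_frequency D g <= mo_frequency D (suffix_episode g).
Proof.
apply: (leq_mo_frequency (p := snd)); first exact: minimal_window_eqr.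
exact: minimal_window_suffix.
Qed.

(** * Comparing non-interleaved frequencies *)

Lemma leq_ni_frequency m m' (g : episode E m.+1) (g' : episode E m'.+1)
    (r : node_map D m.+1 -> node_map D m'.+1) :
  (forall h, occurrence g h -> occurrence g' (r h)) ->
  (forall h1 h2, occurrence g h1 -> occurrence g h2 ->
     non_interleaved h1 h2 -> non_interleaved (r h1) (r h2) /\ r h1 <> r h2) ->
  ni_frequency D g <= ni_frequency D g'.
Proof.
move=> occ_r ni_r; apply/bigmax_leqP=> H.
case/andP=> /forall_inP occH /forall_inP niH.
have niHr h1 h2 : h1 \in H -> h2 \in H -> h1 != h2 ->
    non_interleaved (r h1) (r h2) /\ r h1 <> r h2.
  move=> H1 H2 neq; apply: ni_r; [exact: occH | exact: occH |].
  by have /forall_inP/(_ _ H2)/implyP := niH _ H1; apply.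
have inj_r : {in H &, injective r}.
  move=> h1 h2 H1 H2 eq_r; apply/eqP/negPn/negP=> neq.
  by case: (niHr _ _ H1 H2 neq).
rewrite -(card_in_imset inj_r); apply: leq_bigmax_cond.
apply/andP; split.
  by apply/forall_inP=> _ /imsetP[h /occH occ_h ->]; apply: occ_r.
apply/forall_inP=> _ /imsetP[h1 H1 ->]; apply/forall_inP=> _ /imsetP[h2 H2 ->].
apply/implyP=> neq; apply: (proj1 (niHr _ _ H1 H2 _)).
by apply: contraNneq neq => ->.
Qed.

(** One of the two alternatives in [non_interleaved h1 h2], which unfolds to
    [precedes h1 h2 || precedes h2 h1]. *)
Definition precedes m (h1 h2 : node_map D m.+1) : bool :=
  [forall j : 'I_m, etime (h1 (succ_node j)) <= etime (h2 (pred_node j))].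

(** The restrictions differ at the first node: the first event of [h1] is strictly before its
    second, which is no later than the first event of [h2]. *)
Lemma precedes_prefix m (g : episode E m.+2) h1 h2 :
  occurrence g h1 -> precedes h1 h2 ->
  precedes (prefix_map h1) (prefix_map h2) /\ prefix_map h1 <> prefix_map h2.
Proof.
case/andP=> _ /forallP lt_h1 /forallP le_h; split.
  by apply/forallP=> j; rewrite !ffunE -succ_pred_node.
move=> /ffunP/(_ ord0); rewrite !ffunE => eq0.
by have := leq_trans (lt_h1 ord0) (le_h ord0); rewrite eq0 ltnn.
Qed.

(** The restrictions differ at the last node: the last event of [h1] is no later than the last but
    one of [h2]. The strict step now lies in [h2], so it is [h2] that must be an occurrence. *)
Lemma precedes_suffix m (g : episode E m.+2) h1 h2 :
  occurrence g h2 -> precedes h1 h2 ->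
  precedes (suffix_map h1) (suffix_map h2) /\ suffix_map h1 <> suffix_map h2.
Proof.
case/andP=> _ /forallP lt_h2 /forallP le_h; split.
  by apply/forallP=> j; rewrite !ffunE succ_pred_node.
move=> /ffunP/(_ ord_max); rewrite !ffunE => eqm.
by have := leq_ltn_trans (le_h ord_max) (lt_h2 ord_max); rewrite eqm ltnn.
Qed.

Lemma leq_ni_frequency_prefix m (g : episode E m.+2) :
  ni_frequency D g <= ni_frequency D (prefix_episode g).
Proof.
apply: (@leq_ni_frequency _ _ _ _ (@prefix_map _)) => [h | h1 h2 occ1 occ2].
  by rewrite occurrence_recr => /and3P[].
case/orP=> [/(precedes_prefix occ1) | /(precedes_prefix occ2)] [le neq].
all: split=> //.
- by apply/orP; left.
- by apply/orP; right.
- exact/nesym.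
Qed.

Lemma leq_ni_frequency_suffix m (g : episode E m.+2) :
  ni_frequency D g <= ni_frequency D (suffix_episode g).
Proof.
apply: (@leq_ni_frequency _ _ _ _ (@suffix_map _)) => [h | h1 h2 occ1 occ2].
  by rewrite occurrence_recl => /and3P[].
case/orP=> [/(precedes_suffix occ2) | /(precedes_suffix occ1)] [le neq].
all: split=> //.
- by apply/orP; left.
- by apply/orP; right.
- exact/nesym.
Qed.

End Events.

Theorem theorem2 (E : finType) (N : nat) (alpha : episode E N.+2)
    (D : event_sequence E) :
  (forall f : nat, mo_frequency D alpha = f ->
     f <= mo_frequency D (prefix_episode alpha) /\
     f <= mo_frequency D (suffix_episode alpha)) /\
  (forall f : nat, ni_frequency D alpha = f ->
     f <= ni_frequency D (prefix_episode alpha) /\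
     f <= ni_frequency D (suffix_episode alpha)).
Proof.
split=> _ <-; split.
- exact: leq_mo_frequency_prefix.
- exact: leq_mo_frequency_suffix.
- exact: leq_ni_frequency_prefix.
- exact: leq_ni_frequency_suffix.
Qed.
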